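(* Let $\alpha\in(0,1)$, let $0<\varepsilon\le 1/4$, and let $(\varepsilon_t)_{t\ge 0}$ be a spending sequence as described in the context. Suppose there exist constants $\lambda>0$, $q>1$ and $T\in\mathbb{N}$ such that $\varepsilon_t-\varepsilon_{t-1}\ge \lambda t^{-q}$ for all $t\ge T$. Let $p$ be a random variable with values in $[0,1]$ and cumulative distribution function $F$, and suppose that $F$ is H\''older continuous with exponent $\xi>0$ in a neighborhood of $\alpha$, i.e. there exist an open interval $V\ni\alpha$ and $c>0$ with $|F(x)-F(y)|\le c|x-y|^{\xi}$ for all $x,y\in V$. Let $N\in\mathbb{N}$, let $p_1,\dots,p_N$ be independent copies of $p$, and for each $i$, conditionally on $p_1,\dots,p_N$, let $X^i_1,X^i_2,\dots$ be independent Bernoulli$(p_i)$ variables (independently across $i$). Let $S^i_t=\sum_{j=1}^t X^i_j$ and $\tau_i=\inf\{t\in\mathbb{N}: S^i_t\ge U_t \text{ or } S^i_t\le L_t\}$ (with $\inf\emptyset=\infty$), where $U_t,L_t$ are the stopping boundaries defined in the context, and let $\tau_{(1)}\le\dots\le\tau_{(N)}$ be the order statistics of $\tau_1,\dots,\tau_N$. Then $\mathbb{E}[\tau_{(i)}]<\infty$ for every $i\le N-\lfloor 2/\xi\rfloor$. In particular, if $\xi=1$, then $\mathbb{E}[\tau_{(N-2)}]<\infty$.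
   Context: $\mathbb{N}=\{1,2,\dots\}$. A spending sequence is a sequence $(\varepsilon_t)_{t\ge0}$ of reals with $0\le\varepsilon_0\le\varepsilon_1\le\cdots$ and $\varepsilon_t\to\varepsilon$ as $t\to\infty$. For $r\in[0,1]$, let $\mathbb{P}_r$ denote a probability under which $X_1,X_2,\dots$ are i.i.d. Bernoulli$(r)$, and let $S_t=\sum_{j=1}^t X_j$. The stopping boundaries $(U_t)_{t\in\mathbb{N}}$, $(L_t)_{t\in\mathbb{N}}$ are defined recursively: with $\tau=\inf\{t\in\mathbb{N}: S_t\ge U_t\text{ or } S_t\le L_t\}$ (the events $\{\tau\ge t\}$, $\{\tau<t, S_\tau\ge U_\tau\}$, $\{\tau<t,S_\tau\le L_\tau\}$ depend only on $U_s,L_s$ for $s<t$), $U_t=\min\{j\in\mathbb{N}: \mathbb{P}_\alpha(\tau\ge t, S_t\ge j)+\mathbb{P}_\alpha(\tau<t, S_\tau\ge U_\tau)\le\varepsilon_t\}$, $L_t=\max\{j\in\mathbb{Z}: \mathbb{P}_\alpha(\tau\ge t, S_t\le j)+\mathbb{P}_\alpha(\tau<t, S_\tau\le L_\tau)\le\varepsilon_t\}$. *)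

(* Defs.v *)
From HB Require Import structures.
From mathcomp Require Import all_boot all_order all_algebra.
From mathcomp Require Import all_classical all_reals all_analysis.
Set Implicit Arguments. Unset Strict Implicit. Unset Printing Implicit Defensive.
Import Order.TTheory GRing.Theory Num.Theory numFieldNormedType.Exports.
Local Open Scope ring_scope.
Local Open Scope classical_set_scope.

Section Defs.
Variable R : realType.

(* a 0/1 sequence indexed by time j >= 1 (value at 0 is irrelevant) *)
Definition psum (b : nat -> bool) (t : nat) : nat := \sum_(1 <= j < t.+1) b j.

Definition hit (U L : nat -> int) (b : nat -> bool) (t : nat) : bool :=
  (U t <= (psum b t)%:Z) || ((psum b t)%:Z <= L t).

Definition nostop_before U L b t : bool := all (fun r => ~~ hit U L b r) (iota 1 t.-1).

(* tau < t and S_tau >= U_tau *)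
Definition upper_before U L b t : bool :=
  has (fun s => nostop_before U L b s && (U s <= (psum b s)%:Z)) (iota 1 t.-1).

(* tau < t and S_tau <= L_tau *)
Definition lower_before U L b t : bool :=
  has (fun s => nostop_before U L b s && ((psum b s)%:Z <= L s)) (iota 1 t.-1).

(* a path of length t, read as X_1 .. X_t *)
Definition seqb (s : seq bool) : nat -> bool := fun j => nth false s j.-1.

Definition Pbern (a : R) (t : nat) (E : t.-tuple bool -> bool) : R :=
  \sum_(s : t.-tuple bool | E s) \prod_(x <- s) (if x then a else 1 - a).

(* the stopping boundaries of the context, characterized by their defining
   min / max property at every t in N = {1,2,...} *)
Definition is_boundaries (alpha : R) (eps : nat -> R) (U L : nat -> int) : Prop :=
  forall t : nat, (1 <= t)%N ->
    let condU (j : int) :=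
      Pbern alpha (fun s : t.-tuple bool =>
                     nostop_before U L (seqb s) t && (j <= (psum (seqb s) t)%:Z))
      + Pbern alpha (fun s : t.-tuple bool => upper_before U L (seqb s) t)
      <= eps t in
    let condL (j : int) :=
      Pbern alpha (fun s : t.-tuple bool =>
                     nostop_before U L (seqb s) t && ((psum (seqb s) t)%:Z <= j))
      + Pbern alpha (fun s : t.-tuple bool => lower_before U L (seqb s) t)
      <= eps t in
    [/\ 1 <= U t, condU (U t), (forall j : int, 1 <= j -> condU j -> U t <= j),
        condL (L t) & (forall j : int, condL j -> j <= L t)].

Definition spending (eps : nat -> R) (epsl : R) : Prop :=
  0 <= eps 0%N /\ (forall t, eps t <= eps t.+1) /\ (eps @ \oo --> epsl).

(* tau = inf {t in N : S_t >= U_t or S_t <= L_t}, inf of the empty set = +oo *)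
Definition stop_time (U L : nat -> int) (b : nat -> bool) : \bar R :=
  ereal_inf [set ((t%:R)%:E : \bar R) | t in [set t : nat | (1 <= t)%N /\ hit U L b t]].

(* k-th order statistic (k = 1 .. N) of a family indexed by 'I_N *)
Definition order_stat (N : nat) (f : 'I_N -> \bar R) (k : nat) : \bar R :=
  nth +oo%E (sort (fun x y : \bar R => (x <= y)%E) [seq f i | i <- enum 'I_N]) k.-1.

Definition bern_w (r : R) (x : bool) : R := if x then r else 1 - r.

End Defs.

(* Main.v *)
(** Hoeffding-type bounds give [U_t, L_t = alpha t + O(sqrt t log t)], because the
    error that may be spent at time [t] is at least [lambda t^(-q)].  A path of
    success probability [r] is therefore stopped by time [t], up to a
    negligible error, once [|r - alpha|] exceeds a scale [delta_t] slightly
    larger than [1 / sqrt t]; by Hölder continuity,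
    [P (tau > t) = O(delta_t^xi)].  If the [k]-th order statistic exceeds [t],
    at least [m = N - k + 1] of the [tau_i] do, which by independence has probability
    [O(delta_t^(xi m))], and [xi m > 2] makes this summable.  Only the times
    [t = 4^n] are used, with [delta_t] proportional to [rho^n], where [1/2 < rho < 1] and
    [4 rho^(xi m) < 1]. *)
Require Import Defs.
From HB Require Import structures.
From mathcomp Require Import all_boot all_order all_algebra.
From mathcomp Require Import all_classical all_reals all_analysis.
From mathcomp Require Import measurable_realfun.
From mathcomp Require Import ring lra zify.
Import Order.TTheory GRing.Theory Num.Theory numFieldNormedType.Exports.
Local Open Scope ring_scope.
Local Open Scope classical_set_scope.

Lemma expR_quad_ub {R : realType} (y : R) :
  y <= 1 / 2 -> expR y <= 1 + y + 2 * y ^+ 2.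
Proof.
move=> hy.
have e0 := expR_gt0 y.
have h1 : expR y * (1 - y) <= 1.
  rewrite -[leRHS]expR0 -(subrr y) expRD ler_pM2l //.
  by have := expR_ge1Dx (- y).
have q1 : 1 <= (1 - y) * (1 + y + 2 * y ^+ 2) by nra.
have q0 : 0 <= 1 + y + 2 * y ^+ 2 by nra.
apply: (@le_trans _ _ (expR y * ((1 - y) * (1 + y + 2 * y ^+ 2)))).
  by rewrite ler_peMr // ltW.
by rewrite mulrA -[leRHS]mul1r ler_wpM2r.
Qed.

Lemma tuple_tnth_bij (t : nat) (T : finType) :
  bijective (fun s : t.-tuple T => [ffun i => tnth s i]).
Proof.
exists (fun f : {ffun 'I_t -> T} => [tuple f i | i < t]).
  by move=> s; apply/eq_from_tnth => i; rewrite tnth_mktuple ffunE.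
by move=> f; apply/ffunP => i; rewrite ffunE tnth_mktuple.
Qed.

Lemma sum_tuple_prod {R : realType} (t : nat) (f : bool -> R) :
  \sum_(s : t.-tuple bool) \prod_(x <- s) f x = (f true + f false) ^+ t.
Proof.
rewrite -[X in _ ^+ X](card_ord t) -prodr_const.
under [RHS]eq_bigr do rewrite -(big_bool (@GRing.add R) f).
rewrite bigA_distr_bigA (reindex _ (onW_bij _ (tuple_tnth_bij t bool))) /=.
apply: eq_bigr => s _; rewrite big_tuple.
by apply: eq_bigr => i _; rewrite ffunE.
Qed.

Lemma psum_seqb (s : seq bool) : psum (seqb s) (size s) = (\sum_(x <- s) x)%N.
Proof. by rewrite /psum big_add1 /= (big_nth false). Qed.

Lemma expR_centered_sum {R : realType} (h r : R) (s : seq bool) :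
  \prod_(x <- s) expR (h * (x%:R - r)) =
  expR (h * ((\sum_(x <- s) (x : nat))%N%:R - r * (size s)%:R)).
Proof.
elim: s => [|x s IH]; first by rewrite !big_nil mulr0 subr0 mulr0 expR0.
rewrite !big_cons IH -expRD; congr expR.
by rewrite natrD -[(size (x :: s))]addn1 natrD; ring.
Qed.

Lemma bern_w_ge0 {R : realType} (r : R) x : 0 <= r <= 1 -> 0 <= bern_w r x.
Proof. by move=> /andP[r0 r1]; rewrite /bern_w; case: x; lra. Qed.

Lemma prod_bern_w_ge0 {R : realType} (r : R) (s : seq bool) :
  0 <= r <= 1 -> 0 <= \prod_(x <- s) bern_w r x.
Proof. by move=> r01; apply: prodr_ge0 => x _; exact: bern_w_ge0. Qed.

Lemma Pbern_chernoff {R : realType} (r h z : R) (t : nat)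
    (E : t.-tuple bool -> bool) :
  0 <= r <= 1 -> `|h| <= 1 / 2 ->
  (forall s, E s -> z <= h * ((psum (seqb s) t)%:R - r * t%:R)) ->
  Pbern r E <= expR (2 * h ^+ 2 * t%:R - z).
Proof.
move=> r01 hh hE.
pose g x := bern_w r x * expR (h * (x%:R - r)).
have gS (s : t.-tuple bool) : \prod_(x <- s) g x =
    (\prod_(x <- s) bern_w r x) * expR (h * ((psum (seqb s) t)%:R - r * t%:R)).
  rewrite big_split /= expR_centered_sum; congr (_ * expR (_ * _)).
  by rewrite -psum_seqb size_tuple.
apply: (@le_trans _ _ (\sum_(s : t.-tuple bool) expR (- z) * \prod_(x <- s) g x)).
  rewrite /Pbern [leLHS]big_mkcond; apply: ler_sum => s _; rewrite gS.
  have w0 := prod_bern_w_ge0 r s r01.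
  case: ifPn => [Es|_]; last by rewrite !mulr_ge0 ?expR_ge0.
  rewrite mulrCA -expRD ler_peMr // -[leLHS]expR0 ler_expR.
  by have := hE s Es; lra.
rewrite -mulr_sumr sum_tuple_prod [in leRHS]addrC expRD ler_wpM2l ?expR_ge0 //.
rewrite expRM_natr; apply: lerXn2r; rewrite ?nnegrE ?expR_ge0 //.
  by rewrite addr_ge0 // mulr_ge0 ?expR_ge0 ?bern_w_ge0.
move: r01 => /andP[r0 r1]; move: hh; rewrite ler_norml => /andP[h0 h1].
apply: le_trans (expR_ge1Dx _).
have b1 : h * (1 - r) <= 1 / 2 by nra.
have b2 : h * (0 - r) <= 1 / 2 by nra.
have := expR_quad_ub _ b1; have := expR_quad_ub _ b2.
rewrite /g /bern_w /=.
set e1 := expR _; set e2 := expR _ => q2 q1.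
have m1 : r * e2 <= r * (1 + h * (1 - r) + 2 * (h * (1 - r)) ^+ 2) by exact: ler_wpM2l.
have m2 : (1 - r) * e1 <= (1 - r) * (1 + h * (0 - r) + 2 * (h * (0 - r)) ^+ 2).
  by apply: ler_wpM2l => //; lra.
apply: (le_trans (lerD m1 m2)).
rewrite [leLHS](_ : _ = 1 + 2 * h ^+ 2 * (r * (1 - r))); last by ring.
have hh2 : 0 <= h ^+ 2 by exact: sqr_ge0.
by nra.
Qed.

Lemma eq_psum (b b' : nat -> bool) (t : nat) :
  (forall j, (0 < j <= t)%N -> b j = b' j) -> psum b t = psum b' t.
Proof.
by move=> bb'; apply: eq_big_nat => j /andP[j0 jt]; rewrite bb' // j0 -ltnS.
Qed.

Lemma eq_nostop_before (U L : nat -> int) (b b' : nat -> bool) (t : nat) :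
  (forall j, (0 < j < t)%N -> b j = b' j) ->
  nostop_before U L b t = nostop_before U L b' t.
Proof.
move=> bb'; apply: eq_in_all => r; rewrite mem_iota => /andP[r0 rt].
rewrite /hit (@eq_psum b b' r) // => j /andP[j0 jr].
by rewrite bb' // j0 /=; lia.
Qed.

Lemma seqb_rcons (s : seq bool) (x : bool) (j : nat) :
  (0 < j <= size s)%N -> seqb (rcons s x) j = seqb s j.
Proof. by case: j => // j /= jt; rewrite /seqb /= nth_rcons jt. Qed.

Lemma Pbern_rcons {R : realType} (a : R) (t : nat)
    (E : t.+1.-tuple bool -> bool) (E' : t.-tuple bool -> bool) :
  (forall (s : t.-tuple bool) x, E [tuple of rcons s x] = E' s) -> Pbern a E = Pbern a E'.
Proof.
move=> EE'; pose h (u : t.-tuple bool * bool) := [tuple of rcons u.1 u.2].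
have hb : bijective h.
  apply: inj_card_bij; last by rewrite card_prod !card_tuple card_bool expnSr.
  move=> [s x] [s' x'] /(congr1 val)/= /rcons_inj[ss' ->].
  by congr pair; exact: val_inj.
rewrite /Pbern (reindex h (onW_bij _ hb)) /=.
under eq_bigl => u do rewrite /h EE' -[E' _]andbT.
rewrite -(pair_big E' xpredT
  (fun (s : t.-tuple bool) x => \prod_(y <- rcons s x) if y then a else 1 - a)) /=.
apply: eq_bigr => s _.
under eq_bigr do rewrite big_rcons.
by rewrite big_bool /= -mulrDr [a + _]addrC subrK mulr1.
Qed.

Lemma Pbern_ge0 {R : realType} (a : R) (t : nat) (E : t.-tuple bool -> bool) :
  0 <= a <= 1 -> 0 <= Pbern a E.
Proof. by move=> a01; apply: sumr_ge0 => s _; exact: prod_bern_w_ge0. Qed.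

Lemma le_Pbern {R : realType} (a : R) (t : nat) (E E' : t.-tuple bool -> bool) :
  0 <= a <= 1 -> (forall s, E s -> E' s) -> Pbern a E <= Pbern a E'.
Proof.
move=> a01 EE'; rewrite /Pbern [leLHS]big_mkcond [leRHS]big_mkcond /=.
apply: ler_sum => s _; have w0 := prod_bern_w_ge0 a s a01.
by case: ifPn => [/EE' ->//|_]; case: ifP.
Qed.

Lemma Pbern_orb {R : realType} (a : R) (t : nat) (E E' : t.-tuple bool -> bool) :
  0 <= a <= 1 -> Pbern a (fun s => E s || E' s) <= Pbern a E + Pbern a E'.
Proof.
move=> a01; rewrite /Pbern [leLHS]big_mkcond [X in _ <= X + _]big_mkcond.
rewrite [X in _ <= _ + X]big_mkcond -big_split /=.
apply: ler_sum => s _; have w0 := prod_bern_w_ge0 a s a01.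
by case: (E s); case: (E' s); rewrite /= ?addr0 ?add0r // lerDl.
Qed.

(* Both [upper_before] and [lower_before] are instances, with
   [Q t k := U t <= k] and [Q t k := k <= L t]. *)
Definition exit_before (U L : nat -> int) (Q : nat -> nat -> bool)
    (b : nat -> bool) (t : nat) : bool :=
  has (fun s => nostop_before U L b s && Q s (psum b s)) (iota 1 t.-1).

Lemma exit_beforeS (U L : nat -> int) (Q : nat -> nat -> bool)
    (b : nat -> bool) (t : nat) : (0 < t)%N ->
  exit_before U L Q b t.+1 =
  (nostop_before U L b t && Q t (psum b t)) || exit_before U L Q b t.
Proof.
case: t => // t _; rewrite /exit_before.
have -> : iota 1 t.+2.-1 = iota 1 t ++ [:: t.+1].
  by have := iotaD 1 t 1; rewrite addn1 add1n.
by rewrite has_cat /= orbF orbC.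
Qed.

Lemma eq_exit_before (U L : nat -> int) (Q : nat -> nat -> bool)
    (b b' : nat -> bool) (t : nat) :
  (forall j, (0 < j < t)%N -> b j = b' j) ->
  exit_before U L Q b t = exit_before U L Q b' t.
Proof.
move=> bb'; apply: eq_in_has => r; rewrite mem_iota => /andP[r0 rt].
rewrite (@eq_nostop_before U L b b' r) ?(@eq_psum b b' r) // => j /andP[j0 jr].
  by rewrite bb' // j0 /=; lia.
by rewrite bb' // j0 /=; lia.
Qed.

Lemma Pbern_exit_before {R : realType} (a : R) (U L : nat -> int)
    (Q : nat -> nat -> bool) (eps : nat -> R) :
  0 <= a <= 1 -> 0 <= eps 0 ->
  (forall t, (0 < t)%N ->
    Pbern a (fun s : t.-tuple bool =>
               nostop_before U L (seqb s) t && Q t (psum (seqb s) t)) +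
    Pbern a (fun s : t.-tuple bool => exit_before U L Q (seqb s) t) <= eps t) ->
  forall t, Pbern a (fun s : t.+1.-tuple bool =>
                       exit_before U L Q (seqb s) t.+1) <= eps t.
Proof.
move=> a01 e0 H [|t]; first by rewrite /Pbern big_pred0_eq.
pose E' (s : t.+1.-tuple bool) := (nostop_before U L (seqb s) t.+1 &&
  Q t.+1 (psum (seqb s) t.+1)) || exit_before U L Q (seqb s) t.+1.
rewrite (@Pbern_rcons _ a t.+1 _ E'); last first.
  move=> s x; rewrite /E' exit_beforeS //.
  have sx j : (0 < j <= t.+1)%N -> seqb (rcons s x) j = seqb s j.
    by move=> jt; rewrite seqb_rcons ?size_tuple.
  have sx' j : (0 < j < t.+1)%N -> seqb (rcons s x) j = seqb s j.
    by move=> jt; apply: sx; lia.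
  by rewrite (eq_psum _ _ _ sx) (eq_nostop_before _ _ _ _ _ sx')
    (eq_exit_before _ _ _ _ _ _ sx').
by apply: (le_trans (Pbern_orb _ _ _ _ a01)); exact: H.
Qed.

Lemma upper_boundary_le {R : realType} (a : R) (eps : nat -> R)
    (U L : nat -> int) (t : nat) (j : int) :
  0 <= a <= 1 -> 0 <= eps 0 -> is_boundaries a eps U L -> 1 <= j ->
  Pbern a (fun s : t.+1.-tuple bool => j <= (psum (seqb s) t.+1)%:Z)
    <= eps t.+1 - eps t ->
  U t.+1 <= j.
Proof.
move=> a01 e0 HB j1 Hj.
have [//|_ _ + _ _] := HB t.+1; apply => //.
have := Pbern_exit_before a U L (fun t k => U t <= k%:Z) eps a01 e0.
move=> /(_ _ t) H.
have {}H : Pbern a (fun s : t.+1.-tuple bool => upper_before U L (seqb s) t.+1) <= eps t.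
  by apply: H => r r0; have [] := HB r r0.
rewrite -[leRHS](subrK (eps t)); apply: lerD => //.
by apply: le_trans Hj; apply: le_Pbern => // s /andP[].
Qed.

Lemma lower_boundary_ge {R : realType} (a : R) (eps : nat -> R)
    (U L : nat -> int) (t : nat) (j : int) :
  0 <= a <= 1 -> 0 <= eps 0 -> is_boundaries a eps U L ->
  Pbern a (fun s : t.+1.-tuple bool => (psum (seqb s) t.+1)%:Z <= j)
    <= eps t.+1 - eps t ->
  j <= L t.+1.
Proof.
move=> a01 e0 HB Hj.
have [//|_ _ _ _] := HB t.+1; apply => //.
have := Pbern_exit_before a U L (fun t k => k%:Z <= L t) eps a01 e0.
move=> /(_ _ t) H.
have {}H : Pbern a (fun s : t.+1.-tuple bool => lower_before U L (seqb s) t.+1) <= eps t.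
  by apply: H => r r0; have [] := HB r r0.
rewrite -[leRHS](subrK (eps t)); apply: lerD => //.
by apply: le_trans Hj; apply: le_Pbern => // s /andP[].
Qed.

Lemma Pbern_sqrt_deviation {R : realType} (r v s : R) (t : nat)
    (E : t.+1.-tuple bool -> bool) :
  0 <= r <= 1 -> `|s| <= 1 ->
  (forall b, E b ->
     2 * v * Num.sqrt t.+1%:R <= s * ((psum (seqb b) t.+1)%:R - r * t.+1%:R)) ->
  Pbern r E <= expR (1 - v).
Proof.
move=> r01 s1 Eb; set w := Num.sqrt _ in Eb.
have w2 : w ^+ 2 = t.+1%:R by rewrite sqr_sqrtr.
have w1 : 1 <= w by rewrite -sqrtr1 ler_sqrt ?ler1n.
have w0 : 0 < w by apply: lt_le_trans w1.
have ws : `|s / (2 * w)| <= 1 / 2.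
  rewrite normrM normfV (@ger0_norm _ (2 * w)); last by lra.
  by rewrite ler_pdivrMr; nra.
apply: (le_trans (Pbern_chernoff r (s / (2 * w)) v _ _ r01 ws _)).
  move=> b /Eb; rewrite (mulrAC s) ler_pdivlMr; last by lra.
  by rewrite mulrCA mulrA.
rewrite ler_expR -w2.
have -> : 2 * (s / (2 * w)) ^+ 2 * w ^+ 2 = s ^+ 2 / 2 by field; rewrite gt_eqF.
by have : s ^+ 2 <= 1; [rewrite -real_normK ?num_real // expr_le1 | lra].
Qed.

Lemma Pbern_nostop_le {R : realType} (alpha r v : R) (eps : nat -> R)
    (U L : nat -> int) (t : nat) :
  0 < alpha < 1 -> 0 <= r <= 1 -> 0 <= eps 0 -> is_boundaries alpha eps U L ->
  1 <= v -> expR (1 - v) <= eps t.+1 - eps t ->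
  6 * v <= `|r - alpha| * Num.sqrt t.+1%:R ->
  Pbern r (fun s : t.+1.-tuple bool => nostop_before U L (seqb s) t.+2)
    <= expR (1 - v).
Proof.
move=> /andP[a0 a1] r01 e0 HB v1 Hv Hr.
have a01 : 0 <= alpha <= 1 by rewrite !ltW.
set w := Num.sqrt _ in Hr.
have w2 : t.+1%:R = w ^+ 2 by rewrite sqr_sqrtr.
have w1 : 1 <= w by rewrite -sqrtr1 ler_sqrt ?ler1n.
have w0 : 0 < w by apply: lt_le_trans w1.
have vw : 1 <= v * w by nra.
pose x := alpha * t.+1%:R + 2 * v * w.
have x0 : 0 <= x by rewrite /x w2; nra.
have HU : ((U t.+1)%:~R : R) <= x + 1.
  have HUj : U t.+1 <= Num.floor x + 1.
    apply: (upper_boundary_le _ _ _ _ _ _ a01 e0 HB); first by rewrite lerDr floor_ge0.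
    apply: le_trans Hv; apply: (Pbern_sqrt_deviation alpha v 1); rewrite ?normr1 //.
    move=> b; rewrite -(ler_int R) -pmulrn => hb.
    have := lt_le_trans (floorD1_gt x) hb; rewrite /x -/w mul1r; lra.
  have : ((U t.+1)%:~R : R) <= (Num.floor x + 1)%:~R by rewrite ler_int.
  by rewrite intrD; have := floor_le x; lra.
pose y := alpha * t.+1%:R - 2 * v * w.
have HL : y - 1 <= (L t.+1)%:~R.
  have HLj : Num.floor y <= L t.+1.
    apply: (lower_boundary_ge _ _ _ _ _ _ a01 e0 HB).
    apply: le_trans Hv; apply: (Pbern_sqrt_deviation alpha v (-1)); rewrite ?normrN1 //.
    move=> b; rewrite -(ler_int R) -pmulrn => hb.
    have := le_trans hb (floor_le y); rewrite /y -/w mulN1r; lra.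
  have : ((Num.floor y)%:~R : R) <= (L t.+1)%:~R by rewrite ler_int.
  by have := floorD1_gt y; rewrite intrD; lra.
have bS (b : t.+1.-tuple bool) : nostop_before U L (seqb b) t.+2 ->
    y - 1 < (psum (seqb b) t.+1)%:R < x + 1.
  move=> /allP/(_ t.+1); rewrite mem_iota addnC addn1 /= ltnSn => /(_ isT).
  rewrite /hit negb_or -!ltNge -!(ltr_int R) -pmulrn => /andP[bU bL].
  by rewrite (lt_le_trans bU HU) (le_lt_trans HL bL).
have [ra|ra] := leP alpha r.
- apply: (Pbern_sqrt_deviation r v (-1)); rewrite ?normrN1 // => b /bS/andP[_].
  rewrite /x -/w mulN1r; move: Hr; rewrite ger0_norm ?subr_ge0 // => Hr.
  have : 6 * v * w <= (r - alpha) * w * w by rewrite ler_wpM2r // ltW.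
  rewrite w2; nra.
- apply: (Pbern_sqrt_deviation r v 1); rewrite ?normr1 // => b /bS/andP[+ _].
  rewrite /y -/w mul1r; move: Hr; rewrite ltr0_norm ?subr_lt0 // => Hr.
  have : 6 * v * w <= - (r - alpha) * w * w by rewrite ler_wpM2r // ltW.
  rewrite w2; nra.
Qed.

Lemma ge0_le_integral_nomeas d (T : measurableType d) (R : realType)
    (mu : {measure set T -> \bar R}) (f g : T -> \bar R) :
  (forall x, 0 <= f x)%E -> (forall x, f x <= g x)%E ->
  (\int[mu]_x f x <= \int[mu]_x g x)%E.
Proof.
move=> f0 fg; have g0 x : (0 <= g x)%E by apply: le_trans (fg x).
rewrite !ge0_integralTE //; apply: ereal_sup_le => _ [h hf <-].
by exists h => // x; exact: le_trans (fg x).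
Qed.

Lemma nneseries_geometric_lty {R : realType} (u : nat -> \bar R) (a x : R) :
  0 <= a -> 0 < x < 1 -> (forall n, 0 <= u n <= (a * x ^+ n)%:E)%E ->
  (\sum_(0 <= n <oo) u n < +oo)%E.
Proof.
move=> a0 /andP[x0 x1] hu.
have u0 n : (0 <= n)%N -> true -> (0 <= u n)%E by move=> _ _; case/andP: (hu n).
apply: (@le_lt_trans _ _ (a / (1 - x))%:E); last by rewrite ltey.
apply: lime_le; first exact: is_cvg_nneseries.
near=> n.
apply: (@le_trans _ _ (\sum_(0 <= i < n) (a * x ^+ i)%:E)%E).
  by apply: lee_sum => i _; case/andP: (hu i).
rewrite sumEFin lee_fin.
have := @geometric_le_lim R n a x a0 x0; rewrite gtr0_norm // => /(_ x1).
by rewrite /series /=.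
Unshelve. all: by end_near. Qed.

(* Dominate [f] by [K + \sum_n K 4^(n+1) 1_(E n)]. *)
Lemma integral_lty_of_dyadic_tail d (T : measurableType d) (R : realType)
    (P : probability T R) (f : T -> \bar R) (E : nat -> set T) (K C z : R) :
  (forall w, 0 <= f w)%E -> (forall n, measurable (E n)) ->
  0 < K -> 0 <= C -> 0 < z -> 4 * z < 1 ->
  (forall n w, ~ E n w -> f w <= (K * 4 ^+ n)%:E)%E ->
  (forall n, P (E n) <= (C * z ^+ n)%:E)%E ->
  (\int[P]_w f w < +oo)%E.
Proof.
move=> f0 mE K0 C0 z0 z1 fE PE.
pose u (n : nat) (w : T) : \bar R := ((K * 4 ^+ n.+1)%:E * (\1_(E n) w)%:E)%E.
have K4 n : 0 <= K * 4 ^+ n by rewrite mulr_ge0 ?exprn_ge0 // ltW.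
have u0 n w : (0 <= u n w)%E by rewrite mule_ge0 // lee_fin // ?K4 // indicE; case: (_ \in _).
have mu n : measurable_fun [set: T] (u n : T -> \bar R).
  by apply: emeasurable_funM => //; apply/measurable_EFinP; exact: measurable_indic.
pose g w := (K%:E + \sum_(0 <= n <oo) u n w)%E.
have s0 w : (0 <= \sum_(0 <= n <oo) u n w)%E by apply: nneseries_ge0 => *; exact: u0.
have fg w : (f w <= g w)%E.
  have sE n : E n w -> ((K * 4 ^+ n.+1)%:E <= \sum_(0 <= n <oo) u n w)%E.
    move=> Enw; have <- : u n w = (K * 4 ^+ n.+1)%:E by rewrite /u indicE mem_set // mule1.
    apply: le_trans (nneseries_lim_ge n.+1 _) => [|k _ _]; last exact: u0.
    by rewrite big_nat_recr //= leeDr // sume_ge0.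
  have [allE|] := pselect (forall n, E n w).
    suff -> : g w = +oo%E by rewrite leey.
    apply/eqyP => A A0; rewrite /g.
    have [n hn] : exists n : nat, A <= K * 4 ^+ n.+1.
      pose n := (Num.trunc (A / K)).+1; exists n.
      rewrite -ler_pdivrMl // mulrC; have hA := truncnS_gt (A / K).
      apply: le_trans (ltW hA) _; rewrite -natrX ler_nat.
      by apply: (leq_trans (ltnW (ltn_expl n (isT : (1 < 4)%N)))); rewrite leq_exp2l.
    apply: (@le_trans _ _ (K * 4 ^+ n.+1)%:E); first by rewrite lee_fin.
    by apply: (le_trans (sE n (allE n))); rewrite leeDr // lee_fin ltW.
  move=> /existsNP/cid[n0 hn0].
  have ex : exists n, `[< ~ E n w >] by exists n0; apply/asboolP.
  case: (ex_minnP ex) => -[|n] /asboolP hn min_n; apply: (le_trans (fE _ _ hn)).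
    by rewrite expr0 mulr1 leeDl.
  have Enw : E n w by apply: contrapT => /asboolP/min_n; rewrite ltnn.
  by apply: (le_trans (sE n Enw)); rewrite leeDr // lee_fin ltW.
apply: (le_lt_trans (ge0_le_integral_nomeas _ _ _ P f g f0 fg)).
rewrite /g ge0_integralD //; last first.
- by apply: ge0_emeasurable_sum => // k w _ _; exact: u0.
- by move=> w _; rewrite lee_fin ltW.
rewrite integral_cst // [X in (K%:E * X)%E](probability_setT P) mule1 integral_nneseries //.
apply: lte_add_pinfty; first by rewrite ltey.
apply: (nneseries_geometric_lty _ (4 * K * C) (4 * z)); first by rewrite !mulr_ge0 // ltW.
  by rewrite z1 andbT mulr_gt0.
move=> n; rewrite integral_ge0 //=.
rewrite ge0_integralZl_EFin ?K4 //; last first.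
  by apply/measurable_EFinP; exact: measurable_indic.
rewrite integral_indic // setIT.
apply: (@le_trans _ _ ((K * 4 ^+ n.+1)%:E * (C * z ^+ n)%:E)%E).
  by apply: lee_wpmul2l; [exact: K4 | exact: PE].
by rewrite -EFinM lee_fin exprMn exprS le_eqVlt; apply/orP; left; apply/eqP; ring.
Qed.

Lemma probability_pred_comp d (T : measurableType d) (R : realType)
    (P : probability T R) (I : finType) (Y : T -> I) (Q : pred I) :
  (forall y, measurable [set w | Y w = y]) ->
  measurable [set w | Q (Y w)] /\
  P [set w | Q (Y w)] = (\sum_(y | Q y) P [set w | Y w = y])%E.
Proof.
move=> mY.
have -> : [set w | Q (Y w)] = \bigcup_(y in [set` Q]) [set w | Y w = y].
  apply/seteqP; split => w /=; first by move=> Qw; exists (Y w).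
  by move=> [y Qy /= ->].
have fQ : finite_set [set` Q] by exact: finite_finpred.
split; first by apply: fin_bigcup_measurable.
rewrite measure_fin_bigcup //.
  by rewrite -(bigfs _ (index_enum_uniq I)) // => y _; rewrite mem_index_enum.
by move=> y y' _ _ [w [/= -> ->]].
Qed.

Lemma integral_near_le d (T : measurableType d) (R : realType)
    (P : probability T R) (Y : T -> R) (g : R -> R) (alpha delta e : R) :
  measurable_fun setT Y -> measurable_fun setT g ->
  (forall w, 0 <= g (Y w) <= 1) -> 0 <= e ->
  (forall w, delta <= `|Y w - alpha| -> g (Y w) <= e) ->
  (\int[P]_w (g (Y w))%:E <= e%:E + P [set w | `|Y w - alpha| < delta]%R)%E.
Proof.
move=> mY mg g01 e0 ge.
set A := [set w | _].
have mA : measurable A.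
  rewrite (_ : A = setT `&` Y @^-1` `]alpha - delta, alpha + delta[%classic).
    exact: mY.
  by rewrite setTI /A; apply/seteqP; split => w /=; rewrite in_itv /= ltr_distl.
have -> : P A = (\int[P]_w (\1_A w)%:E)%E by rewrite integral_indic // setIT.
have <- : (\int[P]_w (cst e%:E) w)%E = e%:E.
  by rewrite integral_cst // [X in (_ * X)%E](probability_setT P) mule1.
have mi : measurable_fun [set: T] (fun w => (\1_A w : R)%:E).
  by apply/measurable_EFinP; exact: measurable_indic.
have i0 w : [set: T] w -> (0 <= (\1_A w : R)%:E)%E.
  by rewrite lee_fin indicE; case: (_ \in _).
rewrite -ge0_integralD //.
apply: ge0_le_integral_nomeas => w; first by case/andP: (g01 w).
rewrite -EFinD lee_fin indicE.
have [wA|wA] := boolP (w \in A).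
  by case/andP: (g01 w) => _ g1; rewrite (le_trans g1) // lerDr.
rewrite addr0 ge // leNgt; apply/negP => h; move/negP: wA; apply.
by rewrite mem_set.
Qed.

Lemma cdf_diff d (T : measurableType d) (R : realType)
    (P : probability T R) (Y : T -> R) (F : R -> R) (alpha delta : R) :
  measurable_fun setT Y -> (forall x, P [set w | Y w <= x] = (F x)%:E) ->
  0 < delta ->
  (P [set w | `|Y w - alpha| < delta]%R <=
   (F (alpha + delta) - F (alpha - delta))%:E)%E.
Proof.
move=> mY hF d0.
have mle x : measurable [set w | Y w <= x].
  rewrite (_ : [set w | _] = setT `&` Y @^-1` `]-oo, x]%classic); first exact: mY.
  by rewrite setTI; apply/seteqP; split => w /=; rewrite in_itv.
rewrite EFinB -!hF.
have sub : [set w | Y w <= alpha - delta] `<=` [set w | Y w <= alpha + delta].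
  by move=> w /=; lra.
have fin : (P [set w | Y w <= alpha + delta]%R < +oo)%E by rewrite hF ltey.
have := measureD (mle _) (mle (alpha - delta)) fin; rewrite (setIidr sub) => <-.
apply: le_measure; rewrite ?inE; [|exact: measurableD|].
- rewrite (_ : [set w | _] = setT `&` Y @^-1` `]alpha - delta, alpha + delta[%classic).
    exact: mY.
  by rewrite setTI; apply/seteqP; split => w /=; rewrite in_itv /= ltr_distl.
- by move=> w /=; rewrite ltr_norml => /andP[h1 h2]; split => /=; lra.
Qed.

Lemma Pbern_true {R : realType} (a : R) (t : nat) :
  Pbern a (fun _ : t.-tuple bool => true) = 1.
Proof. by rewrite /Pbern (sum_tuple_prod t (bern_w a)) /bern_w subrKC expr1n. Qed.

Lemma Pbern_le1 {R : realType} (a : R) (t : nat) (Q : t.-tuple bool -> bool) :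
  0 <= a <= 1 -> Pbern a Q <= 1.
Proof. by move=> a01; rewrite -(Pbern_true a t) le_Pbern. Qed.

Lemma measurable_prod_bern_w {R : realType} (s : seq bool) :
  measurable_fun [set: R] (fun a : R => \prod_(x <- s) bern_w a x).
Proof.
apply: measurable_prod => -[] _; rewrite /bern_w //.
exact: measurable_funB.
Qed.

Lemma measurable_Pbern {R : realType} (t : nat) (Q : t.-tuple bool -> bool) :
  measurable_fun [set: R] (fun a : R => Pbern a Q).
Proof.
rewrite /Pbern; under eq_fun do rewrite -big_filter.
by apply: measurable_sum => s; exact: measurable_prod_bern_w.
Qed.

(* Bounds the indicator of [m <= #|b|] by a product over [i], which factors
   under independence. *)
Lemma one_le_card_weight {R : realType} (I : finType) (b : pred I) (m : nat) (h : R) :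
  0 < h -> (m <= #|b|)%N -> 1 <= h ^+ m * \prod_i (1 + (b i)%:R / h).
Proof.
move=> h0 mb.
have -> : \prod_i (1 + (b i)%:R / h) = (1 + h^-1) ^+ #|b|.
  rewrite -prodr_const [RHS]big_mkcond /=; apply: eq_bigr => i _.
  by rewrite unfold_in; case: (b i); rewrite ?mul1r // mul0r addr0.
have h1 : 1 <= 1 + h^-1 by rewrite lerDl invr_ge0 ltW.
apply: (@le_trans _ _ (h ^+ m * (1 + h^-1) ^+ m)).
  by rewrite -exprMn mulrDr mulr1 divff ?gt_eqF // exprn_ege1 // lerDr ltW.
by rewrite ler_pM2l ?exprn_gt0 // ler_weXn2l.
Qed.

Section iid_paths.
Context {R : realType} {d : measure_display} {Omega : measurableType d}.
Context (P : probability Omega R) {N : nat}.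
Context (p : 'I_N -> Omega -> R) (X : 'I_N -> nat -> Omega -> bool).
Context (mp : forall i, measurable_fun setT (p i)).
Context (p01 : forall i w, 0 <= p i w <= 1).
Context (mX : forall i j, measurable [set w | X i j w]).
Context (joint_law :
  forall (n : nat) (B : 'I_N -> set R) (x : 'I_N -> 'I_n -> bool),
     (forall i, measurable (B i)) ->
     P [set w | (forall i, p i w \in B i) /\
                (forall i (j : 'I_n), X i j.+1 w = x i j)]
     = (\prod_(i < N) \int[P]_(w in p i @^-1` B i)
                        (\prod_(j < n) bern_w (p i w) (x i j))%:E)%E).

Definition path_prefix (t : nat) (i : 'I_N) (w : Omega) : t.-tuple bool :=
  [tuple X i j.+1 w | j < t].

Let G (t : nat) (i : 'I_N) (s : t.-tuple bool) : R :=
  fine (\int[P]_w (\prod_(x <- s) bern_w (p i w) x)%:E).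

Let mprod i (s : seq bool) :
  measurable_fun [set: Omega] (fun w => (\prod_(x <- s) bern_w (p i w) x)%:E).
Proof.
apply/measurable_EFinP.
exact: (measurableT_comp (measurable_prod_bern_w s) (mp i)).
Qed.

Let prod_le1 i w (s : seq bool) : \prod_(x <- s) bern_w (p i w) x <= 1.
Proof.
apply: prodr_ile1 => x; rewrite bern_w_ge0 //=.
by have /andP[p0 p1] := p01 i w; rewrite /bern_w; case: x => //; lra.
Qed.

Let GE t i (s : t.-tuple bool) :
  (G t i s)%:E = (\int[P]_w (\prod_(x <- s) bern_w (p i w) x)%:E)%E.
Proof.
rewrite fineK // ge0_fin_numE; last first.
  by apply: integral_ge0 => w _; rewrite lee_fin prod_bern_w_ge0.
apply: (@le_lt_trans _ _ (\int[P]_w (cst 1%:E) w)%E).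
  by apply: ge0_le_integral_nomeas => w; rewrite lee_fin ?prod_bern_w_ge0 ?prod_le1.
by rewrite integral_cst // [X in (_ * X)%E](probability_setT P) mule1 ltey.
Qed.

Let G_ge0 t i (s : t.-tuple bool) : 0 <= G t i s.
Proof.
by rewrite -lee_fin GE; apply: integral_ge0 => w _; rewrite lee_fin prod_bern_w_ge0.
Qed.

Let sumG t i (Q : t.-tuple bool -> bool) :
  (\sum_(s | Q s) G t i s)%:E = (\int[P]_w (Pbern (p i w) Q)%:E)%E.
Proof.
rewrite -sumEFin -big_filter.
under eq_bigr do rewrite GE.
rewrite -ge0_integral_sum // => [|s w _]; last by rewrite lee_fin prod_bern_w_ge0.
by apply: eq_integral => w _; rewrite /Pbern -[in RHS]big_filter sumEFin.
Qed.

Let Y t (w : Omega) : {ffun 'I_N -> t.-tuple bool} := [ffun i => path_prefix t i w].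

Let Y_eq t (y : {ffun 'I_N -> t.-tuple bool}) (w : Omega) :
  Y t w = y <-> forall i (j : 'I_t), X i j.+1 w = tnth (y i) j.
Proof.
split=> [<- i j|H]; first by rewrite ffunE tnth_mktuple.
by apply/ffunP => i; rewrite ffunE; apply: eq_from_tnth => j; rewrite tnth_mktuple.
Qed.

Let measurable_Y t y : measurable [set w | Y t w = y].
Proof.
rewrite (_ : [set w | _] = \bigcap_(i in [set: 'I_N]) \bigcap_(j in [set: 'I_t])
    [set w | X i j.+1 w = tnth (y i) j]); last first.
  by apply/seteqP; split => w /= => [/Y_eq H i _ j _|H]; [exact: H|apply/Y_eq => i j; exact: H].
apply: fin_bigcap_measurable => [|i _]; first exact: finite_finset.
apply: fin_bigcap_measurable => [|j _]; first exact: finite_finset.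
case: (tnth _ _); first exact: mX.
rewrite (_ : [set w | _] = ~` [set w | X i j.+1 w]); first exact/measurableC/mX.
by apply/seteqP; split => w /=; [move=> -> | move/negP/negbTE].
Qed.

Let law_Y t y : P [set w | Y t w = y] = (\prod_i G t i (y i))%:E.
Proof.
have := @joint_law t (fun=> setT) (fun i j => tnth (y i) j) (fun=> measurableT).
rewrite (_ : [set w | _ /\ _] = [set w | Y t w = y]); last first.
  by apply/seteqP; split => w /= => [[_ /Y_eq]|/Y_eq H]; last by split => // i; rewrite inE.
move=> ->; rewrite -prodEFin; apply: eq_bigr => i _.
by rewrite preimage_setT GE; apply: eq_integral => w _; rewrite big_tuple.
Qed.

Lemma prob_card_prefix_le (t : nat) (Q : t.-tuple bool -> bool) (m : nat) (h : R) :
  0 < h -> (forall i, \int[P]_w (Pbern (p i w) Q)%:E <= h%:E)%E ->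
  let E := [set w | (m <= #|[pred i | Q (path_prefix t i w)]|)%N] in
  measurable E /\ (P E <= (h ^+ m * 2 ^+ N)%:E)%E.
Proof.
move=> h0 hQ E.
have EE : E = [set w | (m <= #|[pred i | Q (Y t w i)]|)%N].
  apply/seteqP; split => w; rewrite /E /=; congr (_ <= _)%N; apply: eq_card => i;
    by rewrite !inE ffunE.
rewrite EE; have [mE ->] := probability_pred_comp _ _ _ P _ (Y t)
  (fun y => m <= #|[pred i | Q (y i)]|)%N (@measurable_Y t).
split=> //.
under eq_bigr do rewrite law_Y.
rewrite sumEFin lee_fin.
pose W i (s : t.-tuple bool) := G t i s * (1 + (Q s)%:R / h).
have W0 i s : 0 <= W i s.
  by rewrite mulr_ge0 ?G_ge0 // addr_ge0 // divr_ge0 // ltW.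
apply: (@le_trans _ _ (\sum_(y : {ffun 'I_N -> t.-tuple bool}) h ^+ m * \prod_i W i (y i))).
  rewrite [leLHS]big_mkcond; apply: ler_sum => y _.
  case: ifPn => [my|_]; last by rewrite mulr_ge0 ?exprn_ge0 ?prodr_ge0 // ltW.
  rewrite /W big_split /= mulrCA ler_peMr ?prodr_ge0 //.
  exact: (one_le_card_weight _ [pred i | Q (y i)]).
rewrite -mulr_sumr -bigA_distr_bigA ler_pM2l ?exprn_gt0 //.
rewrite -[X in _ <= _ ^+ X](card_ord N) -prodr_const; apply: ler_prod => i _.
rewrite sumr_ge0 //= /W.
under eq_bigr do rewrite mulrDr mulr1 mulrA.
rewrite big_split /= -mulr_suml [leRHS](_ : 2 = 1 + 1) //.
have -> : \sum_(s : t.-tuple bool) G t i s = 1.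
  apply: EFin_inj; rewrite (sumG t i (fun=> true)).
  under eq_integral do rewrite Pbern_true.
  by rewrite integral_cst // [X in (_ * X)%E](probability_setT P) mule1.
rewrite lerD2l ler_pdivrMr // mul1r -lee_fin.
have -> : \sum_(s : t.-tuple bool) G t i s * (Q s)%:R = \sum_(s | Q s) G t i s.
  by rewrite [RHS]big_mkcond; apply: eq_bigr => s _; case: (Q s); rewrite ?mulr1 ?mulr0.
by rewrite sumG.
Qed.

Lemma nostop_path_prefix (U L : nat -> int) (t : nat) (i : 'I_N) (w : Omega) :
  nostop_before U L (seqb (path_prefix t i w)) t.+1 =
  nostop_before U L (fun j => X i j w) t.+1.
Proof.
apply: eq_nostop_before => -[//|j] /andP[_ jt].
have {}jt : (j < t)%N by [].
by have := tnth_nth false (path_prefix t i w) (Ordinal jt); rewrite tnth_mktuple => ->.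
Qed.

End iid_paths.

Lemma stop_time_le {R : realType} (U L : nat -> int) (b : nat -> bool) (t : nat) :
  ~~ nostop_before U L b t.+1 -> (@stop_time R U L b <= t%:R%:E)%E.
Proof.
rewrite -has_predC => /hasP[r]; rewrite mem_iota add1n ltnS /= negbK => /andP[r1 rt] hr.
apply: (@le_trans _ _ r%:R%:E); last by rewrite lee_fin ler_nat.
by apply: ereal_inf_lbound; exists r.
Qed.

Lemma stop_time_ge0 {R : realType} (U L : nat -> int) (b : nat -> bool) :
  (0 <= @stop_time R U L b)%E.
Proof. by apply: le_ereal_inf_tmp => _ [t _ <-]; rewrite lee_fin. Qed.

Lemma order_stat_ge0 {R : realType} (N : nat) (f : 'I_N -> \bar R) (k : nat) :
  (forall i, 0 <= f i)%E -> (0 <= order_stat f k)%E.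
Proof.
move=> f0; rewrite /order_stat; set s := sort _ _.
have [ks|ks] := ltnP k.-1 (size s); last by rewrite nth_default // leey.
by have := mem_nth +oo%E ks; rewrite mem_sort => /mapP[i _ ->].
Qed.

Lemma order_stat_le {R : realType} (N : nat) (f : 'I_N -> \bar R) (k : nat)
    (x : \bar R) :
  (0 < k <= N)%N -> (#|[pred i | ~~ (f i <= x)%E]| <= N - k)%N ->
  (order_stat f k <= x)%E.
Proof.
case: k => // k /andP[_ kN] hc; rewrite /order_stat /=; set s := sort _ _.
have sN : size s = N by rewrite size_sort size_map size_enum_ord.
rewrite leNgt; apply/negP => xs.
have srt : sorted (fun x y : \bar R => (x <= y)%E) s by apply: sort_sorted => a b; exact: le_total.
have al : all (fun y => ~~ (y <= x)%E) (drop k s).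
  apply/(all_nthP +oo%E) => i; rewrite size_drop sN nth_drop => ik.
  rewrite -ltNge (lt_le_trans xs) //.
  apply: (sorted_leq_nth le_trans le_refl) => //; rewrite ?inE ?sN; lia.
have : (N - k <= count (fun y => ~~ (y <= x)%E) s)%N.
  rewrite -(cat_take_drop k s) count_cat; move: al; rewrite all_count => /eqP ->.
  by rewrite size_drop sN leq_addl.
have -> : count (fun y => ~~ (y <= x)%E) s = #|[pred i | ~~ (f i <= x)%E]|.
  by rewrite (permP (permEl (perm_sort _ _))) count_map cardE size_filter -enumT.
lia.
Qed.

Lemma linear_le_geometric {R : realType} (sigma A B : R) :
  1 < sigma -> 0 <= A -> 0 <= B ->
  exists2 D, 1 <= D & forall n : nat, A + B * n%:R <= D * sigma ^+ n.
Proof.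
move=> s1 A0 B0; have s0 : 0 < sigma - 1 by rewrite subr_gt0.
have bern (n : nat) : 1 + n%:R * (sigma - 1) <= sigma ^+ n.
  elim: n => [|n IH]; first by rewrite mul0r addr0.
  have n0 : 0 <= n%:R * (sigma - 1) ^+ 2 by rewrite mulr_ge0 // sqr_ge0.
  rewrite exprS -[n.+1]addn1 natrD.
  apply: (@le_trans _ _ (sigma * (1 + n%:R * (sigma - 1)))); first by lra.
  by rewrite ler_pM2l //; lra.
have Bs : 0 <= B / (sigma - 1) by rewrite divr_ge0 // ltW.
exists (1 + A + B / (sigma - 1)); first by lra.
move=> n; have := bern n; set s := sigma ^+ n => hs.
have ns : 0 <= n%:R * (sigma - 1) by rewrite mulr_ge0 // ltW.
have h1 : B * n%:R <= B / (sigma - 1) * s.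
  rewrite (_ : B * n%:R = B / (sigma - 1) * (n%:R * (sigma - 1))).
    by apply: ler_wpM2l => //; lra.
  by field; rewrite gt_eqF.
have h2 : A <= A * s by rewrite ler_peMr //; lra.
by nra.
Qed.

Lemma integral_nostop_le d (T : measurableType d) (R : realType)
    (P : probability T R) (Y : T -> R) (F : R -> R) (alpha a b c xi delta v : R)
    (eps : nat -> R) (U L : nat -> int) (t : nat) :
  measurable_fun setT Y -> (forall w, 0 <= Y w <= 1) ->
  (forall x, P [set w | Y w <= x] = (F x)%:E) ->
  (forall x y, a < x < b -> a < y < b -> `|F x - F y| <= c * `|x - y| `^ xi) ->
  0 < alpha < 1 -> 0 <= eps 0 -> is_boundaries alpha eps U L ->
  (0 < t)%N -> 1 <= v -> expR (1 - v) <= eps t - eps t.-1 ->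
  0 < delta -> a < alpha - delta -> alpha + delta < b ->
  6 * v <= delta * Num.sqrt t%:R ->
  (\int[P]_w (Pbern (Y w) (fun s : t.-tuple bool =>
                nostop_before U L (seqb s) t.+1))%:E
   <= (expR (1 - v) + c * (2 * delta) `^ xi)%:E)%E.
Proof.
case: t => // t mY Y01 hF hold a01 e0 HB _ v1 Hv d0 da db hd.
pose g (r : R) := Pbern r (fun s : t.+1.-tuple bool => nostop_before U L (seqb s) t.+2).
apply: (le_trans (@integral_near_le _ _ _ P Y g alpha delta (expR (1 - v)) mY
  (measurable_Pbern _ _) _ (expR_ge0 _) _)) => [w|w hw|].
- by rewrite /g Pbern_ge0 ?Pbern_le1.
- apply: (Pbern_nostop_le alpha _ v eps) => //.
  by apply: (le_trans hd); rewrite ler_wpM2r // sqrtr_ge0.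
- rewrite EFinD leeD2l // (le_trans (cdf_diff _ _ _ _ _ F _ _ mY hF d0)) // lee_fin.
  apply: le_trans (ler_norm _) _.
  have ab : a < alpha < b by apply/andP; split; lra.
  apply: (le_trans (hold _ _ _ _)); try (apply/andP; split; lra).
  rewrite (_ : alpha + delta - (alpha - delta) = 2 * delta); last by ring.
  by rewrite ger0_norm // mulr_ge0 // ltW.
Qed.

Lemma powR_expR {R : realType} (x y : R) : expR x `^ y = expR (y * x).
Proof. by rewrite /powR gt_eqF ?expR_gt0 // expRK. Qed.

Lemma integral_order_stat_lty (R : realType) (alpha : R) (eps : nat -> R)
    (lam q : R) (T0 : nat) (F : R -> R) (xi a b c : R) (U L : nat -> int)
    (d : measure_display) (Omega : measurableType d) (P : probability Omega R)
    (N : nat) (p : 'I_N -> Omega -> R) (X : 'I_N -> nat -> Omega -> bool)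
    (k : nat) :
  0 < alpha < 1 -> 0 <= eps 0 -> 0 < lam -> 0 <= q ->
  (forall t : nat, (T0 <= t)%N -> eps t - eps t.-1 >= lam * (t%:R) `^ (- q)) ->
  is_boundaries alpha eps U L ->
  (forall i, measurable_fun setT (p i)) ->
  (forall i w, 0 <= p i w <= 1) ->
  (forall i (x : R), P [set w | p i w <= x] = (F x)%:E) ->
  0 < xi -> a < alpha < b -> 0 < c ->
  (forall x y, a < x < b -> a < y < b -> `|F x - F y| <= c * `|x - y| `^ xi) ->
  (forall i j, measurable [set w | X i j w]) ->
  (forall (n : nat) (B : 'I_N -> set R) (x : 'I_N -> 'I_n -> bool),
     (forall i, measurable (B i)) ->
     P [set w | (forall i, p i w \in B i) /\
                (forall i (j : 'I_n), X i j.+1 w = x i j)]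
     = (\prod_(i < N) \int[P]_(w in p i @^-1` B i)
                        (\prod_(j < n) bern_w (p i w) (x i j))%:E)%E) ->
  (0 < k <= N)%N -> 2 < xi * (N - k).+1%:R ->
  (\int[P]_w order_stat (fun i => @stop_time R U L (fun j => X i j w)) k < +oo)%E.
Proof.
move=> a01 e0 lam0 q0 heps HB mp p01 hF xi0 /andP[aa ab] c0 hold mX joint kN.
set m := (N - k).+1 => hm.
have l2 : 0 < ln 2 :> R by rewrite ln_gt0 // ltr1n.
pose tau := xi * m%:R.
have tau0 : 0 < tau by apply: lt_trans hm.
pose beta := ln 2 * (1 / 2 + tau^-1).
have itau : tau^-1 < 1 / 2 by rewrite mul1r ltf_pV2 // posrE.
have beta2 : beta < ln 2.
  by rewrite /beta -[ltRHS]mulr1 ltr_pM2l //; lra.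
have beta0 : 0 < beta by rewrite mulr_gt0 // addr_gt0 // invr_gt0.
have betatau : 2 * ln 2 < beta * tau.
  rewrite /beta -mulrA (mulrC 2) ltr_pM2l // mulrDl mulVf ?gt_eqF //.
  by rewrite -/tau in hm; lra.
pose rho := expR (- beta).
have rho0 : 0 < rho := expR_gt0 _.
have rho1 : rho < 1 by rewrite /rho -expR0 ltr_expR oppr_lt0.
have sigma1 : 1 < 2 * rho.
  by rewrite -{1}[2](@lnK R) ?posrE // /rho -expRD expR_gt1 subr_gt0.
pose z := (rho `^ xi) ^+ m.
have zE : z = expR (- (beta * tau)).
  by rewrite /z /rho powR_expR -expRM_natr /tau; congr expR; ring.
have z4 : 4 * z < 1.
  have -> : 4 = expR (2 * ln 2) :> R.
    by rewrite mulrC expRM_natr lnK ?posrE // -natrX.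
  by rewrite zE -expRD expR_lt1 subr_lt0.
have z0 : 0 < z by rewrite zE expR_gt0.
have l4 : 0 <= ln 4 :> R by rewrite ln_ge0 // ler1n.
have [D D1 hD] := linear_le_geometric (2 * rho) (1 + `|ln lam|) (q * ln 4 + xi * beta)
  sigma1 (addr_ge0 ler01 (normr_ge0 _))
  (addr_ge0 (mulr_ge0 q0 l4) (mulr_ge0 (ltW xi0) (ltW beta0))).
pose v n := D * (2 * rho) ^+ n.
have v1 n : 1 <= v n by rewrite mulr_ege1 // exprn_ege1 // ltW.
have D0 : 0 < D by apply: lt_le_trans D1.
have ev1 (n : nat) : expR (1 - v n) <= lam * ((4 ^ n)%N%:R) `^ (- q).
  rewrite -[lam]lnK ?posrE // natrX -[4](@lnK R) ?posrE // -expRM_natr powR_expR.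
  rewrite -expRD ler_expR; have := hD n; have := ler_norm (- ln lam); rewrite normrN.
  have : 0 <= xi * beta * n%:R by rewrite mulr_ge0 // mulr_ge0 ?ltW.
  by rewrite /v; lra.
have ev2 (n : nat) : expR (1 - v n) <= (rho `^ xi) ^+ n.
  rewrite /rho powR_expR -expRM_natr ler_expR; have := hD n; have := normr_ge0 (ln lam).
  have : 0 <= q * ln 4 * n%:R by rewrite !mulr_ge0.
  by rewrite /v; lra.
pose delta n := 6 * D * rho ^+ n.
have delta0 n : 0 < delta n by rewrite !mulr_gt0 // exprn_gt0.
have [n0 [n0T hn0]] : exists n0, (T0 <= n0)%N /\ forall n, (n0 <= n)%N ->
    a < alpha - delta n /\ alpha + delta n < b.
  have cv : delta @ \oo --> (0 : R).
    by apply: cvg_geometric; rewrite ger0_norm // ltW.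
  have r0 : 0 < Num.min (alpha - a) (b - alpha) by rewrite lt_min !subr_gt0 aa.
  have [n1 _ hn1] := cvgr_lt _ cv _ r0.
  exists (maxn T0 n1); split; first exact: leq_maxl.
  move=> n; rewrite geq_max => /andP[_ /hn1/=]; rewrite lt_min => /andP[]; lra.
pose H := 1 + c * (12 * D) `^ xi.
have H0 : 0 < H by rewrite addr_gt0 // mulr_gt0 // powR_gt0 // mulr_gt0.
have hb n i : (n0 <= n)%N ->
    (\int[P]_w (Pbern (p i w) (fun s : (4 ^ n).-tuple bool =>
        nostop_before U L (seqb s) (4 ^ n).+1))%:E <= (H * (rho `^ xi) ^+ n)%:E)%E.
  move=> nn0; have [da db] := hn0 n nn0.
  have Tn : (T0 <= 4 ^ n)%N.
    by rewrite (leq_trans n0T) // (leq_trans nn0) // ltnW // ltn_expl.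
  apply: le_trans (integral_nostop_le _ _ _ P (p i) F alpha a b c xi (delta n) (v n)
    eps U L _ (mp i) (p01 i) (hF i) hold a01 e0 HB _ (v1 n) _ (delta0 n) da db _) _.
  - by rewrite expn_gt0.
  - exact: le_trans (ev1 n) (heps _ Tn).
  - rewrite natrX (_ : 4 = 2 ^+ 2 :> R); last by rewrite -natrX.
    rewrite exprAC sqrtr_sqr.
    by rewrite ger0_norm ?exprn_ge0 // /v /delta exprMn; lra.
  - rewrite lee_fin /H [leRHS]mulrDl mul1r lerD // -mulrA ler_pM2l //.
    rewrite (_ : 2 * delta n = 12 * D * rho ^+ n); last by rewrite /delta; ring.
    have rn : 0 <= rho ^+ n by rewrite exprn_ge0 // ltW.
    rewrite powRM //; last by rewrite mulr_ge0 // ltW.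
    rewrite (_ : (rho ^+ n) `^ xi = (rho `^ xi) ^+ n) //.
    by rewrite /rho powR_expR -!expRM_natr powR_expR mulrA.
pose t n := (4 ^ (n0 + n))%N.
pose E n := [set w | (m <= #|[pred i | nostop_before U L
  (seqb (path_prefix X (t n) i w)) (t n).+1]|)%N].
have hE n : measurable (E n) /\
    (P (E n) <= ((H * (rho `^ xi) ^+ (n0 + n)) ^+ m * 2 ^+ N)%:E)%E.
  apply: (prob_card_prefix_le P p X mp p01 mX joint (t n)
    (fun s => nostop_before U L (seqb s) (t n).+1)) => [|i].
    by rewrite mulr_gt0 // exprn_gt0 // powR_gt0.
  by apply: hb; exact: leq_addr.
apply: (@integral_lty_of_dyadic_tail _ _ _ P _ E (4 ^+ n0)
  (H ^+ m * z ^+ n0 * 2 ^+ N) z) => //.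
- by move=> w; apply: order_stat_ge0 => i; exact: stop_time_ge0.
- by move=> n; case: (hE n).
- apply: mulr_ge0; last exact: exprn_ge0.
  by apply: mulr_ge0; apply: exprn_ge0; exact: ltW.
- move=> n w /negP; rewrite -ltnNge ltnS => hw; rewrite -exprD -natrX.
  apply: order_stat_le => //; apply: leq_trans hw.
  apply/subset_leq_card/fintype.subsetP => i; rewrite !inE; apply: contraR.
  by rewrite nostop_path_prefix => ?; exact: stop_time_le.
- move=> n; case: (hE n) => _ /le_trans; apply; rewrite lee_fin.
  by rewrite exprMn exprAC -/z exprD; lra.
Qed.

Theorem theorem1 (R : realType) (alpha epsl : R) (eps : nat -> R)
  (lam q : R) (T0 : nat) (F : R -> R) (xi : R)
  (U L : nat -> int)
  (d : measure_display) (Omega : measurableType d) (P : probability Omega R)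
  (N : nat) (p : 'I_N -> Omega -> R) (X : 'I_N -> nat -> Omega -> bool) :
  0 < alpha < 1 ->
  0 < epsl <= 1 / 4 ->
  spending eps epsl ->
  0 < lam -> 1 < q -> (1 <= T0)%N ->
  (forall t : nat, (T0 <= t)%N -> eps t - eps t.-1 >= lam * (t%:R) `^ (- q)) ->
  is_boundaries alpha eps U L ->
  (* p_1, ..., p_N : random variables in [0,1] with common c.d.f. F *)
  (forall i, measurable_fun setT (p i)) ->
  (forall i w, 0 <= p i w <= 1) ->
  (forall i (x : R), P [set w | p i w <= x] = (F x)%:E) ->
  (* F is Hoelder continuous with exponent xi in a neighbourhood of alpha *)
  0 < xi ->
  (exists a b c : R, a < alpha < b /\ 0 < c /\
     forall x y, a < x < b -> a < y < b -> `|F x - F y| <= c * `|x - y| `^ xi) ->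
  (* the X^i_j are random variables *)
  (forall i j, measurable [set w | X i j w]) ->
  (* joint law: the p_i are independent, and conditionally on p_1..p_N the
     X^i_1, X^i_2, ... are independent Bernoulli(p_i), independently across i *)
  (forall (n : nat) (B : 'I_N -> set R) (x : 'I_N -> 'I_n -> bool),
     (forall i, measurable (B i)) ->
     P [set w | (forall i, p i w \in B i) /\
                (forall i (j : 'I_n), X i j.+1 w = x i j)]
     = (\prod_(i < N) \int[P]_(w in p i @^-1` B i)
                        (\prod_(j < n) bern_w (p i w) (x i j))%:E)%E) ->
  let tau := fun (i : 'I_N) (w : Omega) => @stop_time R U L (fun j => X i j w) in
  (forall k : nat, (1 <= k)%N -> (k%:Z + Num.floor (2 / xi) <= N%:Z)%R ->
     (\int[P]_w order_stat (fun i => tau i w) k < +oo)%E)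
  /\ (xi = 1 -> (3 <= N)%N ->
     (\int[P]_w order_stat (fun i => tau i w) (N - 2) < +oo)%E).
Proof.
move=> a01 _ [e0 _] lam0 q1 _ heps HB mp p01 hF xi0 [a [b [c [aab [c0 hold]]]]] mX joint tau.
have main k : (0 < k <= N)%N -> 2 < xi * (N - k).+1%:R ->
    (\int[P]_w order_stat (fun i => tau i w) k < +oo)%E.
  exact: (integral_order_stat_lty R alpha eps lam q T0 F xi a b c U L d Omega P N p X k
    a01 e0 lam0 (le_trans ler01 (ltW q1)) heps HB mp p01 hF xi0 aab c0 hold mX joint).
split=> [k k1 hk|xi1 N3]; last first.
  apply: main; first by apply/andP; split; lia.
  by rewrite subKn ?xi1 ?mul1r ?ltr_nat //; lia.
have f0 : 0 <= Num.floor (2 / xi) by rewrite floor_ge0 divr_ge0 // ltW.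
have kN : (k <= N)%N by lia.
apply: main; first by rewrite k1.
rewrite mulrC -ltr_pdivrMr //; apply: (lt_le_trans (floorD1_gt _)).
by rewrite [leRHS]pmulrn ler_int -[(N - k).+1]addn1 PoszD -subzn // lerD2r lerBrDl.
Qed.
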